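(* Let $h,k,\mu$ be pairwise relatively prime odd positive integers with $h,k\ge 3$, and for integers $n$ put $\xi_n=e^{2\pi i n/k}$, $\omega_n=e^{2\pi i n/h}$, $\nu_n=e^{2\pi i n/\mu}$. Let $\alpha$ be either $0$ or a positive integer with $(\alpha,h)=1$, and let $\beta$ be either $0$ or a positive integer with $(\beta,k)=1$. Then $$h\mu\sum_{j=1}^{k-1}\frac{1}{(\xi_{j+\beta}^{\mu}\omega_\alpha^{\mu}+1)(\xi_j^h-1)}+k\mu\sum_{j=1}^{h-1}\frac{1}{(\xi_\beta^{\mu}\omega_{\alpha+j}^{\mu}+1)(\omega_j^k-1)}-hk\sum_{j=1}^{\mu}\frac{1}{(\omega_\alpha^k\nu_j^k+1)(\xi_\beta^h\nu_j^h+1)}$$ $$=-hk\mu\left(\frac{1}{\omega_\alpha^{k\mu}+1}+\frac{1}{\xi_\beta^{h\mu}+1}\right)+\mu\left(\mu+\frac k2+\frac h2\right)\frac{1}{\xi_\beta^\mu\omega_\alpha^\mu+1}-\frac{\mu^2}{(\xi_\beta^\mu\omega_\alpha^\mu+1)^2}.$$ *)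

(* Defs.v *)
From mathcomp Require Import all_boot all_order all_algebra.
From mathcomp Require Import complex.
From mathcomp Require Import reals sequences exp trigo.

Set Implicit Arguments.
Unset Strict Implicit.
Unset Printing Implicit Defensive.

Import Order.TTheory GRing.Theory Num.Theory.
Local Open Scope ring_scope.
Local Open Scope complex_scope.

(* MathComp-Analysis has no complex exponential on R[i]; this is
   e^(a + i b) = e^a (cos b + i sin b). *)
Definition cexp (R : realType) (z : R[i]) : R[i] :=
  (expR (complex.Re z))%:C * (cos (complex.Im z) +i* sin (complex.Im z)).

Definition expi2pi (R : realType) (m : nat) (n : int) : R[i] :=
  cexp (2 * (pi : R)%:C * 'i%C * n%:~R / m%:R).

(* Main.v *)
(* Put a = omega_alpha, b = xi_beta, c = (a b)^mu.  The identity is the vanishing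
   of the sum of the residues of 1 / (z (z^h - 1) (z^k - 1) (c z^mu + 1)):
   the first two sums come from the nontrivial k-th and h-th roots of unity, the
   right-hand terms in 1 / (c + 1) from the double pole z = 1, and at the zeros
   z = -1 / (a b nu_j) of c z^mu + 1 the residue is, up to the factor -1 / mu,
   (1 - 1 / (a^k nu_j^k + 1)) (1 - 1 / (b^h nu_j^h + 1)).  Expanding this product
   gives the third sum and two single sums, evaluated by residues as well. *)

Require Import Defs.
From mathcomp Require Import all_boot all_order all_algebra.
From mathcomp Require Import complex.
From mathcomp Require Import reals sequences exp trigo.
From mathcomp Require Import ring zify.

Import Order.TTheory GRing.Theory Num.Theory.
Local Open Scope ring_scope.
Local Open Scope complex_scope.

(** * Sums of residues at simple poles *)

Section Residues.

Variables (F : fieldType) (P : {poly F}) (s : seq F).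
Hypotheses (s_uniq : uniq s) (s_root : all (root P) s).
Hypothesis P_size : size P = (size s).+1.

Let P_neq0 : P != 0. Proof. by rewrite -size_poly_eq0 P_size. Qed.

Let divX r : r \in s -> P %/ ('X - r%:P) * ('X - r%:P) = P.
Proof. by move=> rs; rewrite divpK // dvdp_XsubCl (allP s_root). Qed.

Let size_divX r : size (P %/ ('X - r%:P)) = size s.
Proof. by rewrite size_divp ?polyXsubC_eq0 // size_XsubC subn1 P_size. Qed.

Let lead_divX r : r \in s -> lead_coef (P %/ ('X - r%:P)) = lead_coef P.
Proof.
by move=> /(divX r) {2}<-; rewrite lead_coefM lead_coefXsubC mulr1.
Qed.

Let divX_at r : r \in s -> (P %/ ('X - r%:P)).[r] = P^`().[r].
Proof.
by move=> /(divX r) {2}<-; rewrite derivM derivXsubC !hornerE subrr mulr0 add0r.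
Qed.

Let divX_off r t : r \in s -> t \in s -> t != r -> (P %/ ('X - r%:P)).[t] = 0.
Proof.
move=> rs ts tr; apply/(mulIf (_ : t - r != 0)); first by rewrite subr_eq0.
have /eqP := allP s_root _ ts.
by rewrite -{1}(divX r rs) !hornerE => ->; rewrite ?mul0r.
Qed.

Lemma deriv_simple_root_neq0 r : r \in s -> P^`().[r] != 0.
Proof.
move=> rs; apply/negP => /eqP P'0; move: P_neq0; rewrite -(divX r rs).
suff -> : P %/ ('X - r%:P) = 0 by rewrite mul0r eqxx.
apply: (@roots_geq_poly_eq0 _ _ s _ s_uniq); last by rewrite size_divX.
apply/allP => t ts; rewrite rootE; have [->|tr] := eqVneq t r.
  by rewrite divX_at ?P'0.
by rewrite divX_off.
Qed.

(* Lagrange interpolation of [g] at the roots of [P]; the sum is, up to the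
   leading coefficient of [P], the top coefficient of the interpolant. *)
Lemma sum_residues0 (g : {poly F}) :
  (size g < size s)%N -> \sum_(r <- s) g.[r] / P^`().[r] = 0.
Proof.
move=> g_size.
pose L := \sum_(r <- s) (g.[r] / P^`().[r]) *: (P %/ ('X - r%:P)).
have gL : g - L = 0.
  apply: (@roots_geq_poly_eq0 _ _ s _ s_uniq).
    apply/allP => t ts; rewrite rootE !hornerE horner_sum (bigD1_seq t) //=.
    rewrite big_seq_cond big1 => [|r /andP[rs rt]].
      rewrite hornerZ divX_at // divfK ?deriv_simple_root_neq0 //.
      by rewrite addr0 subrr.
    by rewrite hornerZ divX_off 1?eq_sym // mulr0.
  rewrite (leq_trans (size_polyD _ _)) // geq_max (ltnW g_size) size_polyN.
  rewrite (leq_trans (size_sum _ _ _)) //.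
  apply/bigmax_leqP_seq => r rs _.
  by rewrite (leq_trans (size_scale_leq _ _)) // size_divX.
have s_gt0 : (0 < size s)%N by apply: leq_ltn_trans g_size.
(* In degree [(size s).-1] every cofactor has coefficient [lead_coef P], whereas [g] has coefficient
   0 there by the size bound. *)
have : (g - L)`_(size s).-1 = 0 by rewrite gL coef0.
rewrite coefB nth_default ?sub0r; last by rewrite -ltnS prednK.
move/eqP; rewrite oppr_eq0 coef_sum.
under eq_big_seq => r rs.
  rewrite coefZ -(size_divX r) -/(lead_coef _) lead_divX //; over.
by rewrite -mulr_suml mulf_eq0 lead_coef_eq0 (negPf P_neq0) orbF => /eqP.
Qed.

End Residues.

(** * Adding a double pole outside the simple ones *)

Section DoublePole.

Variables (F : fieldType) (P : {poly F}) (s : seq F).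
Hypotheses (s_uniq : uniq s) (s_root : all (root P) s).
Hypothesis P_size : size P = (size s).+1.

(* The residue theorem for [1 / ((X - c)^2 P)]: apply [sum_residues0] to
   [(X - c) P] and to the difference quotient [(P - P(c)) / (X - c)]. *)
Lemma sum_residues_double_pole (c : F) :
    P.[c] != 0 -> (0 < size s)%N ->
  \sum_(r <- s) 1 / ((r - c) ^+ 2 * P^`().[r]) = P^`().[c] / P.[c] ^+ 2.
Proof.
move=> Pc_neq0 s_gt0.
have /factor_theorem[H HP] : root (P - P.[c]%:P) c.
  by rewrite rootE !hornerE subrr.
have PE : P = H * ('X - c%:P) + P.[c]%:P by rewrite -HP subrK.
have H_size : size H = size s.
  have := congr1 (fun p : {poly F} => size p) HP.
  rewrite size_polyDl ?P_size ?size_polyN; last first.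
    by rewrite (leq_ltn_trans (size_polyC_leq1 _)) // ltnS.
  have [->|H0] := eqVneq H 0; first by rewrite mul0r size_poly0.
  by rewrite size_Mmonic ?monicXsubC // size_XsubC addn2 /= => -[].
have Hc : H.[c] = P^`().[c].
  by rewrite PE !derivE !hornerE subrr; ring.
have cs : c \notin s.
  by apply: contra Pc_neq0 => /(allP s_root); rewrite rootE.
have Hr r : r \in s -> H.[r] * (r - c) = - P.[c].
  move=> /(allP s_root)/rootP; rewrite {1}PE !hornerE.
  by move/eqP; rewrite addr_eq0 => /eqP.
have Q_uniq : uniq (c :: s) by rewrite /= cs.
have Q_root : all (root (P * ('X - c%:P))) (c :: s).
  apply/allP => r; rewrite inE rootM root_XsubC => /predU1P[->|rs].
    by rewrite eqxx orbT.
  by rewrite (allP s_root).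
have Q_size : size (P * ('X - c%:P)) = (size (c :: s)).+1.
  by rewrite size_Mmonic ?monicXsubC -?size_poly_eq0 ?P_size // size_XsubC addn2.
have Q_deriv r : (P * ('X - c%:P))^`().[r] = P^`().[r] * (r - c) + P.[r].
  by rewrite derivM derivXsubC !hornerE.
have := sum_residues0 F _ _ Q_uniq Q_root Q_size H.
rewrite /= H_size ltnSn => /(_ isT)/eqP.
rewrite big_cons.
under eq_big_seq => r rs.
  have rc : r - c != 0.
    by rewrite subr_eq0; apply: contraNneq cs => <-.
  have -> : H.[r] / (P * ('X - c%:P))^`().[r]
     = - P.[c] * (1 / ((r - c) ^+ 2 * P^`().[r])).
    have P'r := deriv_simple_root_neq0 F P s s_uniq s_root P_size r rs.
    have /rootP Pr := allP s_root _ rs.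
    rewrite Q_deriv Pr -(Hr r rs); field.
    by rewrite P'r.
  over.
rewrite -mulr_sumr Q_deriv subrr Hc mulr0 add0r mulNr subr_eq0.
move=> /eqP e; apply: (mulfI Pc_neq0); rewrite -e; field.
by rewrite Pc_neq0.
Qed.

End DoublePole.

(** * Elementary facts on roots of unity *)

(** Bezout: [u * m = v * n + 1] turns the two equations into [x = 1]. *)
Lemma coprime_unity_root (R : nzRingType) (m n : nat) (x : R) :
  (0 < m)%N -> coprime m n -> x ^+ m = 1 -> x ^+ n = 1 -> x = 1.
Proof.
move=> m_gt0 co_mn xm xn; case: (egcdnP n m_gt0) => u v e _.
have := congr1 (GRing.exp x) e; rewrite (eqP co_mn) exprD expr1.
by rewrite mulnC exprM xm expr1n mulnC exprM xn expr1n mul1r.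
Qed.

(** The range contains at most [n] consecutive exponents, so two distinct ones are never congruent
    modulo [n]. *)
Lemma uniq_prim_root_powers (R : nzRingType) (n m p : nat) (x : R) :
  n.-primitive_root x -> (p <= m + n)%N ->
  uniq [seq x ^+ j | j <- index_iota m p].
Proof.
move=> x_prim le_p; rewrite map_inj_in_uniq ?iota_uniq // => i j.
wlog le_ij : i j / (i <= j)%N => [IH|].
  by case/orP: (leq_total i j) => le ? ? ?; [|symmetry]; apply: IH.
rewrite !mem_index_iota => /andP[mi ip] /andP[mj jp] /eqP.
rewrite eq_sym (eq_prim_root_expr x_prim) eqn_mod_dvd //.
have [|ji_gt0 /(dvdn_leq ji_gt0)] := posnP (j - i); lia.
Qed.

(** An odd power of -1 is -1, which differs from 1 in characteristic zero. This is what keeps the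
    denominators of the reciprocity formula away from 0. *)
Lemma odd_unity_rootD1_neq0 (F : numDomainType) (n : nat) (u : F) :
  odd n -> u ^+ n = 1 -> u + 1 != 0.
Proof.
move=> odd_n un; rewrite addr_eq0; apply/eqP => uE; move/eqP: un.
by rewrite uE -signr_odd odd_n expr1 eq_sym -addr_eq0 -mulr2n pnatr_eq0.
Qed.

(* Residues of [n X^(n-1) / ((X + 1) (X^n - u^n))]. *)
Lemma sum_inv_prim_rootD1 (F : numFieldType) (n : nat) (z u : F) :
    odd n -> n.-primitive_root z -> u != 0 -> u ^+ n + 1 != 0 ->
  \sum_(1 <= j < n.+1) 1 / (u * z ^+ j + 1) = n%:R / (u ^+ n + 1).
Proof.
move=> odd_n z_prim u0 un1.
have n_gt0 : (0 < n)%N := odd_gt0 odd_n.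
have zn : z ^+ n = 1 := prim_expr_order z_prim.
pose P : {poly F} := ('X - (-1)%:P) * ('X^n - (u ^+ n)%:P).
pose w := [seq u * z ^+ j | j <- index_iota 1 n.+1].
have wn r : r \in w -> r ^+ n = u ^+ n.
  by case/mapP=> j _ ->; rewrite exprMn exprAC zn expr1n mulr1.
have wN1 : -1 \notin w.
  apply: contra un1 => /wn <-.
  by rewrite -signr_odd odd_n expr1 addNr.
have s_uniq : uniq (-1 :: w).
  rewrite /= wN1 /w (map_comp ( *%R u) (GRing.exp z)).
  rewrite map_inj_uniq; last exact: mulfI.
  exact: uniq_prim_root_powers z_prim _.
have s_root : all (root P) (-1 :: w).
  apply/allP=> r; rewrite inE rootM root_XsubC => /predU1P[->|/wn rn].
    by rewrite eqxx.
  by rewrite [X in _ || X]rootE !hornerE rn subrr eqxx orbT.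
have P_size : size P = (size (-1 :: w)).+1.
  rewrite size_monicM ?monicXsubC // -?size_poly_eq0 size_XnsubC //.
  by rewrite size_XsubC /= size_map size_iota subn1.
have P_deriv r : P^`().[r] = (r ^+ n - u ^+ n) + (r + 1) * (n%:R * r ^+ n.-1).
  rewrite derivM derivXsubC derivB derivXn derivC subr0 mul1r.
  rewrite !(hornerD, hornerM, hornerN, hornerMn, hornerXn, hornerX, hornerC).
  by rewrite -mulr_natl opprK.
(* The numerator is the derivative of ['X^n - (u ^+ n)%:P], so it cancels at each [u * z ^+ j] and
   leaves [1 / (u * z ^+ j + 1)]. *)
have := sum_residues0 F _ _ s_uniq s_root P_size (n%:R *: 'X^(n.-1)).
rewrite /= size_map size_iota subn1 /=.
rewrite (leq_ltn_trans (size_scale_leq _ _)); last by rewrite size_polyXn prednK.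
move=> /(_ isT); rewrite big_cons big_map !P_deriv addNr mul0r addr0.
under eq_big_seq => j jP.
  have rw : u * z ^+ j \in w by apply/mapP; exists j.
  have r0 : u * z ^+ j != 0.
    rewrite mulf_neq0 // expf_neq0 //; apply/eqP => z0.
    by move/eqP: zn; rewrite z0 expr0n gtn_eqF // eq_sym oner_eq0.
  have r1 : u * z ^+ j + 1 != 0.
    by rewrite addr_eq0; apply: contraNneq wN1 => <-.
  have -> : (n%:R *: 'X^(n.-1)).[u * z ^+ j] / P^`().[u * z ^+ j]
     = 1 / (u * z ^+ j + 1).
    rewrite P_deriv wn // hornerZ hornerXn subrr add0r.
    have n0 : n%:R != 0 :> F by rewrite pnatr_eq0 -lt0n.
    have r' : (u * z ^+ j) ^+ n.-1 != 0 by rewrite expf_neq0.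
    by rewrite invfM mulrCA divff ?mulf_neq0 // mulr1 mul1r.
  over.
(* The residue at -1 is [n (-1)^(n-1) / ((-1)^n - u^n)], that is [- n / (u^n + 1)] for odd [n]. *)
have sgn : (-1) ^+ n = -1 :> F by rewrite -signr_odd odd_n expr1.
have sgn' : (-1) ^+ n.-1 = 1 :> F.
  by apply: oppr_inj; rewrite -[LHS]mulN1r -exprS prednK.
rewrite hornerZ hornerXn sgn sgn' mulr1 -opprD invrN mulrN addrC.
by move/eqP; rewrite subr_eq0 [1 + _]addrC => /eqP.
Qed.

(** * The polynomial [(X^n - 1) / (X - 1)] and its values at 1 *)

Section GeometricPolynomial.

Variables (F : fieldType) (n : nat).

Let G : {poly F} := \sum_(i < n) 'X^i.

Lemma geometric_polyE : G * ('X - 1%:P) = 'X^n - 1%:P.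
Proof. by rewrite mulrC !polyC1 subrX1. Qed.

Lemma size_geometric_poly : (0 < n)%N -> size G = n.
Proof.
move=> n_gt0; have := congr1 (fun p : {poly F} => size p) geometric_polyE.
rewrite size_XnsubC //; have [->|G0] := eqVneq G 0.
  by rewrite mul0r size_poly0.
by rewrite size_Mmonic ?monicXsubC // size_XsubC addn2 /= => -[].
Qed.

Lemma geometric_poly_root (r : F) : r ^+ n = 1 -> r != 1 -> root G r.
Proof.
move=> rn r1; have := congr1 (horner^~ r) geometric_polyE.
rewrite !hornerE rn subrr => /eqP.
by rewrite mulf_eq0 subr_eq0 (negPf r1) orbF.
Qed.

Lemma geometric_poly1 : G.[1] = n%:R.
Proof.
rewrite horner_sum; under eq_bigr do rewrite hornerXn expr1n.
by rewrite sumr_const card_ord.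
Qed.

(** Differentiating [G (X - 1) = X^n - 1] twice and evaluating at 1 kills the term in the second
    derivative of [G]. The factor 2 stays on the left because the field may have characteristic
    2. *)
Lemma deriv_geometric_poly1 : 2 * G^`().[1] = n%:R * (n%:R - 1).
Proof.
have := congr1 (fun p : {poly F} => p^`()^`().[1]) geometric_polyE.
rewrite /= derivM derivXsubC mulr1 derivB derivXn derivC subr0.
rewrite derivD derivM derivXsubC mulr1 derivMn derivXn.
rewrite !(hornerD, hornerM, hornerN, hornerMn, hornerXn, hornerX, hornerC).
rewrite expr1n subrr mulr0 add0r -mulr2n mulr_natl => ->.
case: (n) => [|m]; first by rewrite mulr0n mul0r.
by rewrite /= -[m.+1%:R in RHS]natr1 addrK natr1 mulr_natl.
Qed.

End GeometricPolynomial.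

(** * The residue identity for the roots of unity and the zeros of [c X^mu + 1] *)

Section Reciprocity.

Variables (F : numFieldType) (h k mu : nat).
Hypotheses (odd_h : odd h) (odd_k : odd k) (odd_mu : odd mu).
Hypothesis co_hk : coprime h k.

Let h_gt0 : (0 < h)%N := odd_gt0 odd_h.
Let k_gt0 : (0 < k)%N := odd_gt0 odd_k.
Let mu_gt0 : (0 < mu)%N := odd_gt0 odd_mu.
Let h_neq0 : h%:R != 0 :> F. Proof. by rewrite pnatr_eq0 -lt0n. Qed.
Let k_neq0 : k%:R != 0 :> F. Proof. by rewrite pnatr_eq0 -lt0n. Qed.
Let mu_neq0 : mu%:R != 0 :> F. Proof. by rewrite pnatr_eq0 -lt0n. Qed.

Variable c : F.
Hypothesis c_unity : c ^+ (h * k) = 1.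

(* [P = X (X^h - 1) (X^k - 1) (c X^mu + 1) / (X - 1)^2] *)
Let D : {poly F} := c *: 'X^mu + 1%:P.
Let P : {poly F} := 'X * (\sum_(i < h) 'X^i) * (\sum_(i < k) 'X^i) * D.

Let horner_D r : D.[r] = c * r ^+ mu + 1.
Proof. by rewrite !(hornerD, hornerZ, hornerXn, hornerC). Qed.

Let c_neq0 : c != 0.
Proof.
apply/eqP => c0; move/eqP: c_unity.
by rewrite c0 expr0n muln_eq0 !gtn_eqF // eq_sym oner_eq0.
Qed.

Let size_D : size D = mu.+1.
Proof.
rewrite size_polyDl size_scale // size_polyXn //.
by rewrite (leq_ltn_trans (size_polyC_leq1 _)).
Qed.

(** [c * r ^+ mu] is again a root of unity of odd exponent [h * k], hence not -1. *)
Let unity_D_neq0 r : r ^+ (h * k) = 1 -> c * r ^+ mu + 1 != 0.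
Proof.
move=> rhk; apply: (@odd_unity_rootD1_neq0 _ (h * k)).
  by rewrite oddM odd_h.
by rewrite exprMn c_unity exprAC rhk expr1n mul1r.
Qed.

Let size_P : size P = (h + k + mu)%N.
Proof.
have Gh := size_geometric_poly F h h_gt0.
have Gk := size_geometric_poly F k k_gt0.
have D0 : D != 0 by rewrite -size_poly_eq0 size_D.
have Gh0 : \sum_(i < h) 'X^i != 0 :> {poly F}.
  by rewrite -size_poly_eq0 Gh -lt0n.
have Gk0 : \sum_(i < k) 'X^i != 0 :> {poly F}.
  by rewrite -size_poly_eq0 Gk -lt0n.
rewrite !size_mul ?mulf_neq0 ?polyX_eq0 // size_polyX Gh Gk size_D.
lia.
Qed.

Let PE : P * ('X - 1%:P) ^+ 2 = 'X * ('X^h - 1%:P) * ('X^k - 1%:P) * D.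
Proof. by rewrite -!geometric_polyE /P; ring. Qed.

(** Differentiate [PE] at [r]: the term containing [P.[r]] drops out. The four summands come from
    the factors [X], [X^h - 1], [X^k - 1] and [D] in turn, and at each kind of pole only one of them
    is nonzero. *)
Let deriv_P r : root P r ->
  (r - 1) ^+ 2 * P^`().[r] =
  (r ^+ h - 1) * (r ^+ k - 1) * (c * r ^+ mu + 1)
  + h%:R * r ^+ h * (r ^+ k - 1) * (c * r ^+ mu + 1)
  + k%:R * r ^+ k * (r ^+ h - 1) * (c * r ^+ mu + 1)
  + mu%:R * (c * r ^+ mu) * (r ^+ h - 1) * (r ^+ k - 1).
Proof.
move/rootP; move: (P) PE => Q QE Pr.
have := congr1 (fun p : {poly F} => p^`().[r]) QE.
rewrite /= expr2 !derivM !derivB !derivX !derivC !derivXn derivD derivZ.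
rewrite derivXn derivC.
rewrite !(hornerD, hornerM, hornerN, hornerMn, hornerXn, hornerX, hornerC).
rewrite !(hornerZ, hornerMn, hornerXn) Pr.
have expE n : (0 < n)%N -> r ^+ n = r * r ^+ n.-1.
  by move=> n_gt0; rewrite -exprS prednK.
rewrite -[r ^+ h.-1 *+ h]mulr_natl -[r ^+ k.-1 *+ k]mulr_natl.
rewrite -[r ^+ mu.-1 *+ mu]mulr_natl (expE h) // (expE k) // (expE mu) // => e.
by apply: etrans (etrans _ e) _; ring.
Qed.

Let P1 : P.[1] = h%:R * k%:R * (c + 1).
Proof.
rewrite !hornerM hornerX !geometric_poly1 horner_D expr1n.
ring.
Qed.

Let deriv_P1 : 2 * P^`().[1] =
  h%:R * k%:R * ((h%:R + k%:R) * (c + 1) + 2 * mu%:R * c).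
Proof.
have := deriv_geometric_poly1 F h; have := deriv_geometric_poly1 F k.
have := geometric_poly1 F h; have := geometric_poly1 F k; rewrite /P.
move: (\sum_(i < h) 'X^i) (\sum_(i < k) 'X^i) => A B B1 A1 B'1 A'1.
rewrite !derivM derivX derivD derivZ derivXn derivC.
rewrite !(hornerD, hornerM, hornerMn, hornerXn, hornerX, hornerC, hornerZ).
rewrite A1 B1 !expr1n.
transitivity (2 * (h%:R * k%:R * (c + 1)) + (2 * A^`().[1]) * k%:R * (c + 1)
  + h%:R * (2 * B^`().[1]) * (c + 1) + 2 * h%:R * k%:R * c * mu%:R).
  by ring.
by rewrite A'1 B'1; ring.
Qed.

Variables (x y : F) (z : seq F).
Hypotheses (x_prim : k.-primitive_root x) (y_prim : h.-primitive_root y).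
Hypotheses (z_uniq : uniq z) (z_size : size z = mu).
Hypothesis z_root : {in z, forall r, c * r ^+ mu = -1}.

Let xs := [seq x ^+ j | j <- index_iota 1 k].
Let ys := [seq y ^+ j | j <- index_iota 1 h].

Let prim_powersP n (t r : F) : n.-primitive_root t ->
  r \in [seq t ^+ j | j <- index_iota 1 n] -> r ^+ n = 1 /\ r != 1.
Proof.
move=> t_prim /mapP[j]; rewrite mem_index_iota => /andP[j0 jn] ->.
rewrite exprAC (prim_expr_order t_prim) expr1n; split=> //.
by rewrite -(prim_order_dvd t_prim) gtnNdvd.
Qed.

Let xsP := prim_powersP k x ^~ x_prim.
Let ysP := prim_powersP h y ^~ y_prim.

Let z_hk r : r \in z -> r ^+ (h * k) != 1.
Proof.
move=> rz; apply/eqP => /unity_D_neq0.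
by rewrite z_root // addNr eqxx.
Qed.

Let poles := 0 :: xs ++ ys ++ z.

(** A common element of [xs] and [ys] would be 1, as [h] and [k] are coprime; an element of [z] is
    in neither list, since its power [h * k] is not 1. *)
Let poles_uniq : uniq poles.
Proof.
have xs0 : 0 \notin xs.
  by apply/negP => /xsP[/eqP]; rewrite expr0n gtn_eqF // eq_sym oner_eq0.
have ys0 : 0 \notin ys.
  by apply/negP => /ysP[/eqP]; rewrite expr0n gtn_eqF // eq_sym oner_eq0.
have z0 : 0 \notin z.
  apply/negP => /z_root/eqP; rewrite expr0n gtn_eqF // mulr0.
  by rewrite eq_sym oppr_eq0 oner_eq0.
rewrite /= !mem_cat !negb_or xs0 ys0 z0 /= !cat_uniq z_uniq andbT.
rewrite (uniq_prim_root_powers F _ _ _ _ x_prim) ?leq_addl //=.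
rewrite (uniq_prim_root_powers F _ _ _ _ y_prim) ?leq_addl //=.
rewrite has_cat negb_or -andbA; apply/and3P; split; apply/hasPn => r.
- move=> /ysP[rh r1]; apply/negP => /xsP[rk _]; case/eqP: r1.
  exact: coprime_unity_root h_gt0 co_hk rh rk.
- move=> /z_hk; apply: contra => /xsP[rk _].
  by rewrite mulnC exprM rk expr1n.
- move=> /z_hk; apply: contra => /ysP[rh _].
  by rewrite exprM rh expr1n.
Qed.

Let poles_root : all (root P) poles.
Proof.
apply/allP => r; rewrite inE !mem_cat !rootM => /predU1P[->|/or3P[/xsP|/ysP|]].
- by rewrite rootE hornerX eqxx.
- by case=> rk r1; rewrite (geometric_poly_root F k) // orbT.
- by case=> rh r1; rewrite (geometric_poly_root F h) // orbT.
- by move=> /z_root e; rewrite [root D r]rootE horner_D e addNr eqxx orbT.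
Qed.

Let poles_size : size P = (size poles).+1.
Proof. rewrite size_P /= !size_cat !size_map !size_iota z_size; lia. Qed.

Lemma sum_residues_roots_of_unity :
  1 + k%:R^-1 * (\sum_(1 <= j < k)
        1 / ((c * (x ^+ j) ^+ mu + 1) * ((x ^+ j) ^+ h - 1)))
    + h%:R^-1 * (\sum_(1 <= j < h)
        1 / ((c * (y ^+ j) ^+ mu + 1) * ((y ^+ j) ^+ k - 1)))
    - mu%:R^-1 * (\sum_(r <- z) 1 / ((r ^+ h - 1) * (r ^+ k - 1)))
  = ((h%:R + k%:R) / 2 * (c + 1) + mu%:R * c) / (h%:R * k%:R * (c + 1) ^+ 2).
Proof.
have c1 : c + 1 != 0.
  by have := unity_D_neq0 1; rewrite !expr1n mulr1; apply.
have Pc1 : P.[1] != 0 by rewrite P1 !mulf_neq0.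
have := sum_residues_double_pole F P poles poles_uniq poles_root poles_size
  1 Pc1 isT.
have -> : P^`().[1] / P.[1] ^+ 2 =
   ((h%:R + k%:R) / 2 * (c + 1) + mu%:R * c) / (h%:R * k%:R * (c + 1) ^+ 2).
  have two0 : 2 != 0 :> F by rewrite pnatr_eq0.
  have := deriv_P1; rewrite P1 => e.
  have -> : P^`().[1] =
      (h%:R * k%:R * ((h%:R + k%:R) * (c + 1) + 2 * mu%:R * c)) / 2.
    by rewrite -e; field.
  by field; rewrite h_neq0 k_neq0 c1.
move=> <-; rewrite big_cons !big_cat /= !big_map /=.
rewrite deriv_P; last by rewrite (allP poles_root) ?mem_head.
rewrite !expr0n !gtn_eqF //= !addrA; congr (_ + _ + _ + _).
- by rewrite !(mulr0, mul0r, addr0, add0r, sub0r) mulrNN !mulr1 divr1.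
- rewrite mulr_sumr; apply: eq_big_seq => j jP.
  have rx : x ^+ j \in xs by apply/mapP; exists j.
  have [rk _] := xsP _ rx.
  rewrite deriv_P; last by rewrite (allP poles_root) // inE mem_cat rx orbT.
  rewrite rk subrr !(mulr0, mul0r, addr0, add0r) mulr1 !mul1r -invfM.
  by congr _^-1; ring.
- rewrite mulr_sumr; apply: eq_big_seq => j jP.
  have ry : y ^+ j \in ys by apply/mapP; exists j.
  have [rh _] := ysP _ ry.
  rewrite deriv_P; last by rewrite (allP poles_root) // inE !mem_cat ry !orbT.
  rewrite rh subrr !(mulr0, mul0r, addr0, add0r) mulr1 !mul1r -invfM.
  by congr _^-1; ring.
- rewrite -mulrN -sumrN mulr_sumr; apply: eq_big_seq => r rz.
  rewrite deriv_P; last by rewrite (allP poles_root) // inE !mem_cat rz !orbT.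
  rewrite z_root // addNr !(mulr0, mul0r, addr0, add0r) !mul1r -invrN -invfM.
  by congr _^-1; ring.
Qed.

End Reciprocity.

(** * The reciprocity formula in terms of primitive roots *)

Lemma root_of_unity_reciprocity (F : numFieldType) (h k mu : nat)
    (x y n a b : F) :
    odd h -> odd k -> odd mu ->
    coprime h k -> coprime h mu -> coprime k mu ->
    k.-primitive_root x -> h.-primitive_root y -> mu.-primitive_root n ->
    a ^+ h = 1 -> b ^+ k = 1 ->
  h%:R * mu%:R *
      (\sum_(1 <= j < k)
         1 / (((x ^+ j * b) ^+ mu * a ^+ mu + 1) * ((x ^+ j) ^+ h - 1)))
  + k%:R * mu%:R *
      (\sum_(1 <= j < h)
         1 / ((b ^+ mu * (a * y ^+ j) ^+ mu + 1) * ((y ^+ j) ^+ k - 1)))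
  - h%:R * k%:R *
      (\sum_(1 <= j < mu.+1)
         1 / ((a ^+ k * (n ^+ j) ^+ k + 1) * (b ^+ h * (n ^+ j) ^+ h + 1)))
  = - (h%:R * k%:R * mu%:R
       * (1 / (a ^+ (k * mu)%N + 1) + 1 / (b ^+ (h * mu)%N + 1)))
    + mu%:R * (mu%:R + k%:R / 2 + h%:R / 2) * (1 / (b ^+ mu * a ^+ mu + 1))
    - mu%:R ^+ 2 / (b ^+ mu * a ^+ mu + 1) ^+ 2.
Proof.
move=> odd_h odd_k odd_mu co_hk co_hmu co_kmu x_prim y_prim n_prim ah bk.
have unity_neq0 m (t : F) : odd m -> t ^+ m = 1 -> t != 0.
  move=> odd_m tm; apply/eqP => t0; move/eqP: tm.
  by rewrite t0 expr0n gtn_eqF ?odd_gt0 // eq_sym oner_eq0.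
have nmu : n ^+ mu = 1 := prim_expr_order n_prim.
have a0 : a != 0 by apply: unity_neq0 ah.
have b0 : b != 0 by apply: unity_neq0 bk.
have n0 : n != 0 by apply: unity_neq0 nmu.
have h0 : h%:R != 0 :> F by rewrite pnatr_eq0 -lt0n odd_gt0.
have k0 : k%:R != 0 :> F by rewrite pnatr_eq0 -lt0n odd_gt0.
have mu0 : mu%:R != 0 :> F by rewrite pnatr_eq0 -lt0n odd_gt0.
set c := b ^+ mu * a ^+ mu.
have c_unity : c ^+ (h * k) = 1.
  have ahk : a ^+ (h * k) = 1 by rewrite exprM ah expr1n.
  have bhk : b ^+ (h * k) = 1 by rewrite mulnC exprM bk expr1n.
  by rewrite exprMn exprAC bhk expr1n mul1r exprAC ahk expr1n.
have c1 : c + 1 != 0.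
  by apply: odd_unity_rootD1_neq0 c_unity; rewrite oddM odd_h.
pose f (v : F) := - (a * b * v)^-1.
pose z := [seq f (n ^+ j) | j <- index_iota 1 mu.+1].
have z_size : size z = mu by rewrite size_map size_iota subn1.
have z_uniq : uniq z.
  rewrite /z (map_comp f (GRing.exp n)) map_inj_uniq.
    exact: uniq_prim_root_powers n_prim _.
  by move=> u v /oppr_inj/invr_inj; apply: mulfI; rewrite mulf_neq0.
have z_root : {in z, forall r, c * r ^+ mu = -1}.
  move=> r /mapP[j _ ->]; rewrite exprNn -signr_odd odd_mu expr1.
  rewrite exprVn !exprMn [(n ^+ j) ^+ mu]exprAC nmu expr1n mulr1 mulN1r mulrN.
  by rewrite -[a ^+ mu * _]mulrC -/c divff // mulf_neq0 ?expf_neq0.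
have := sum_residues_roots_of_unity F h k mu odd_h odd_k odd_mu co_hk
  c c_unity x y z x_prim y_prim z_uniq z_size z_root.
rewrite /z big_map.
pose A j := 1 / (a ^+ k * (n ^+ j) ^+ k + 1).
pose B j := 1 / (b ^+ h * (n ^+ j) ^+ h + 1).
(* Since [k] is prime to [mu], [n ^+ k] is again a primitive root of order [mu], so
   [sum_inv_prim_rootD1] applies with [u = a ^+ k]. *)
have sumA : \sum_(1 <= j < mu.+1) A j = mu%:R / (a ^+ (k * mu) + 1).
  rewrite exprM -(@sum_inv_prim_rootD1 _ _ (n ^+ k)) ?expf_neq0 //.
  - by apply: eq_bigr => j _; rewrite /A exprAC.
  - by rewrite prim_root_exp_coprime.
  - apply: (odd_unity_rootD1_neq0 _ h) => //.
    by rewrite -exprM exprAC ah expr1n.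
have sumB : \sum_(1 <= j < mu.+1) B j = mu%:R / (b ^+ (h * mu) + 1).
  rewrite exprM -(@sum_inv_prim_rootD1 _ _ (n ^+ h)) ?expf_neq0 //.
  - by apply: eq_bigr => j _; rewrite /B exprAC.
  - by rewrite prim_root_exp_coprime.
  - apply: (odd_unity_rootD1_neq0 _ k) => //.
    by rewrite -exprM exprAC bk expr1n.
have inv_mul (u v : F) : 1 / (u * v) = 1 / u * (1 / v) by rewrite !div1r invfM.
(* With [w = u ^+ m * v ^+ m], the odd power of [f] is [- 1 / w], and
   [1 / (- 1 / w - 1) = - w / (w + 1)]. It is used once with [t = a] and once with [t = b]; the two
   minus signs cancel in the product. *)
have inv_f m (t u v : F) l : odd m -> odd l -> t ^+ m = 1 -> u ^+ l = 1 ->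
    v ^+ mu = 1 -> v != 0 -> u != 0 ->
  1 / ((- (t * u * v)^-1) ^+ m - 1) = - (1 - 1 / (u ^+ m * v ^+ m + 1)).
  move=> odd_m odd_l tm ul vmu v0 u0.
  rewrite exprNn -signr_odd odd_m expr1 exprVn !exprMn tm [1 * u ^+ m]mul1r.
  have : u ^+ m * v ^+ m + 1 != 0.
    apply: (odd_unity_rootD1_neq0 _ (l * mu)); first by rewrite oddM odd_l.
    rewrite -exprMn exprAC exprMn exprM ul expr1n.
    by rewrite mulnC exprM vmu !expr1n mulr1 expr1n.
  have : u ^+ m * v ^+ m != 0 by rewrite mulf_neq0 ?expf_neq0.
  set w := u ^+ m * v ^+ m => w0 w1; field.
  by rewrite w0 w1 mulN1r -opprD oppr_eq0 addrC w1.
have sum3 : \sum_(j <- index_iota 1 mu.+1)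
      1 / ((f (n ^+ j) ^+ h - 1) * (f (n ^+ j) ^+ k - 1))
   = mu%:R - mu%:R / (a ^+ (k * mu) + 1) - mu%:R / (b ^+ (h * mu) + 1)
     + \sum_(1 <= j < mu.+1)
         1 / ((a ^+ k * (n ^+ j) ^+ k + 1) * (b ^+ h * (n ^+ j) ^+ h + 1)).
  rewrite -sumA -sumB.
  have -> : mu%:R = \sum_(1 <= j < mu.+1) (1 : F).
    by rewrite sumr_const_nat subn1.
  rewrite -!sumrB -big_split; apply: eq_bigr => j _ /=.
  have njmu : (n ^+ j) ^+ mu = 1 by rewrite exprAC nmu expr1n.
  have nj0 : n ^+ j != 0 by rewrite expf_neq0.
  have /= eB := inv_f h a b _ k odd_h odd_k ah bk njmu nj0 b0.
  have /= := inv_f k b a _ h odd_k odd_h bk ah njmu nj0 a0.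
  rewrite [b * a]mulrC => eA.
  rewrite !inv_mul eA eB -/(A j) -/(B j); ring.
rewrite sum3.
have -> : \sum_(1 <= j < k)
    1 / (((x ^+ j * b) ^+ mu * a ^+ mu + 1) * ((x ^+ j) ^+ h - 1))
  = \sum_(1 <= j < k) 1 / ((c * (x ^+ j) ^+ mu + 1) * ((x ^+ j) ^+ h - 1)).
  by apply: eq_bigr => j _; rewrite exprMn -mulrA [X in X + 1]mulrC.
have -> : \sum_(1 <= j < h)
    1 / ((b ^+ mu * (a * y ^+ j) ^+ mu + 1) * ((y ^+ j) ^+ k - 1))
  = \sum_(1 <= j < h) 1 / ((c * (y ^+ j) ^+ mu + 1) * ((y ^+ j) ^+ k - 1)).
  by apply: eq_bigr => j _; rewrite exprMn mulrA.
move: (\sum_(_ <= _ < k) _) (\sum_(_ <= _ < h) _) (\sum_(_ <= _ < mu.+1) _).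
move=> S1 S2 S3 e.
rewrite !div1r; move: (a ^+ _ + 1)^-1 (b ^+ _ + 1)^-1 e => A' B' e.
(* The residue 1 at the pole 0 cancels [mu%:R^-1 * mu%:R], and the two single sums leave [A' + B'],
   whose compensation is the first term on the right of the formula. *)
transitivity (h%:R * k%:R * mu%:R * (1 + k%:R^-1 * S1 + h%:R^-1 * S2
    - mu%:R^-1 * (mu%:R - mu%:R * A' - mu%:R * B' + S3))
  - h%:R * k%:R * mu%:R * (A' + B')).
  by field; rewrite h0 k0 mu0.
have two0 : 2 != 0 :> F by rewrite pnatr_eq0.
(* Writing [mu c] as [mu (c + 1) - mu] splits the contribution of the double pole into the terms in
   [1 / (c + 1)] and [1 / (c + 1)^2]. *)
by rewrite e; field; rewrite h0 k0 c1.
Qed.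

(** Passage to sequences indexed by integers: the exponential law turns the shifted indices into the
    products with [b = xi beta] and [a = omega alpha]. *)
Lemma power_reciprocity (F : numFieldType) (h k mu alpha beta : nat)
    (xi omega nu : int -> F) :
    odd h -> odd k -> odd mu ->
    coprime h k -> coprime h mu -> coprime k mu ->
    (forall j : nat, xi j = xi 1 ^+ j) ->
    (forall j : nat, omega j = omega 1 ^+ j) ->
    (forall j : nat, nu j = nu 1 ^+ j) ->
    k.-primitive_root (xi 1) -> h.-primitive_root (omega 1) ->
    mu.-primitive_root (nu 1) ->
  h%:R * mu%:R *
      (\sum_(1 <= j < k)
         1 / ((xi (j%:Z + beta%:Z) ^+ mu * omega alpha%:Z ^+ mu + 1)
              * (xi j%:Z ^+ h - 1)))
  + k%:R * mu%:R *
      (\sum_(1 <= j < h)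
         1 / ((xi beta%:Z ^+ mu * omega (alpha%:Z + j%:Z) ^+ mu + 1)
              * (omega j%:Z ^+ k - 1)))
  - h%:R * k%:R *
      (\sum_(1 <= j < mu.+1)
         1 / ((omega alpha%:Z ^+ k * nu j%:Z ^+ k + 1)
              * (xi beta%:Z ^+ h * nu j%:Z ^+ h + 1)))
  = - (h%:R * k%:R * mu%:R
       * (1 / (omega alpha%:Z ^+ (k * mu)%N + 1)
          + 1 / (xi beta%:Z ^+ (h * mu)%N + 1)))
    + mu%:R * (mu%:R + k%:R / 2 + h%:R / 2)
      * (1 / (xi beta%:Z ^+ mu * omega alpha%:Z ^+ mu + 1))
    - mu%:R ^+ 2 / (xi beta%:Z ^+ mu * omega alpha%:Z ^+ mu + 1) ^+ 2.
Proof.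
move=> odd_h odd_k odd_mu co_hk co_hmu co_kmu xiX omegaX nuX.
move=> x_prim y_prim n_prim.
have ah : omega alpha ^+ h = 1.
  by rewrite omegaX exprAC (prim_expr_order y_prim) expr1n.
have bk : xi beta ^+ k = 1.
  by rewrite xiX exprAC (prim_expr_order x_prim) expr1n.
rewrite -(root_of_unity_reciprocity _ h k mu _ _ _ _ _ odd_h odd_k odd_mu
  co_hk co_hmu co_kmu x_prim y_prim n_prim ah bk).
congr (_ * _ + _ * _ - _ * _); apply: eq_bigr => j _.
- by rewrite -PoszD (xiX (j + beta)%N) (xiX j) (xiX beta) exprD.
- by rewrite -PoszD (omegaX (alpha + j)%N) (omegaX j) (omegaX alpha) exprD.
- by rewrite (nuX j).
Qed.

(** * The complex exponential gives primitive roots of unity *)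

Section Expi2pi.

Variables (R : realType) (m : nat).

Lemma expi2piE (n : int) :
  expi2pi R m n = cos (2 * pi * n%:~R / m%:R) +i* sin (2 * pi * n%:~R / m%:R).
Proof.
have argE : 2 * (pi : R)%:C * 'i%C * n%:~R / m%:R
    = 'i%C * (2 * pi * n%:~R / m%:R)%:C :> R[i].
  rewrite !(rmorphM, fmorphV, rmorph_int, rmorph_nat).
  by rewrite [_ * 'i%C]mulrC !mulrA.
rewrite /expi2pi argE /cexp /=.
by rewrite !(mul0r, mul1r, mulr0, subr0, add0r, addr0, sub0r, oppr0) expR0 mul1r.
Qed.

Lemma expi2piD (n p : int) : expi2pi R m (n + p) = expi2pi R m n * expi2pi R m p.
Proof.
rewrite !expi2piE intrD mulrDr mulrDl cosD sinD; apply/eqP.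
by rewrite eq_complex /= eqxx; apply/eqP/addrC.
Qed.

Lemma expi2piX (n : nat) : expi2pi R m n = expi2pi R m 1 ^+ n.
Proof.
elim: n => [|n IHn]; last by rewrite exprS -IHn -expi2piD.
by rewrite expi2piE mulr0 mul0r cos0 sin0.
Qed.

(** The order [d] divides [m]. If [d < m], then [t = pi d / m] lies strictly between 0 and [pi], so
    [sin t > 0]; but [cos (2 t) = 1] forces [sin t = 0]. *)
Lemma expi2pi_prim : (0 < m)%N -> m.-primitive_root (expi2pi R m 1).
Proof.
move=> m_gt0; have m0 : 0 < m%:R :> R by rewrite ltr0n.
have Em : expi2pi R m 1 ^+ m = 1.
  rewrite -expi2piX expi2piE mulfK ?gt_eqF // mulr_natl.
  by rewrite cos2pi sin2pi.
have [d d_prim d_dvd] := prim_order_exists m_gt0 Em.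
have d_gt0 := prim_order_gt0 d_prim.
suff d_m : d = m by rewrite d_m in d_prim.
apply/eqP; rewrite eqn_leq (dvdn_leq m_gt0 d_dvd) leqNgt.
apply/negP => lt_dm.
have := prim_expr_order d_prim; rewrite -expi2piX expi2piE => /eqP.
rewrite eq_complex /= => /andP[/eqP cos1 _].
pose t : R := pi * d%:R / m%:R.
have t2 : 2 * pi * d%:~R / m%:R = t *+ 2 by rewrite /t -mulr_natl; ring.
have : 0 < sin t.
  apply: sin_gt0_pi; rewrite /t !mulr_gt0 ?invr_gt0 ?ltr0n ?pi_gt0 //=.
  by rewrite ltr_pdivrMr // ltr_pM2l ?pi_gt0 // ltr_nat.
move: cos1; rewrite t2 cos_mulr2n cos2sin2 => /eqP.
rewrite -subr_eq0.
have -> : (1 - sin t ^+ 2) *+ 2 - 1 - 1 = - 2 * sin t ^+ 2 by ring.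
rewrite mulf_eq0 oppr_eq0 pnatr_eq0 expf_eq0 /= => /eqP ->.
by rewrite ltxx.
Qed.

End Expi2pi.

Theorem mainTheorem12 (R : realType) (h k mu alpha beta : nat)
    (odd_h : odd h) (odd_k : odd k) (odd_mu : odd mu)
    (h_ge3 : (3 <= h)%N) (k_ge3 : (3 <= k)%N) (mu_gt0 : (0 < mu)%N)
    (co_hk : coprime h k) (co_hmu : coprime h mu) (co_kmu : coprime k mu)
    (alphaP : alpha = 0%N \/ (0 < alpha)%N /\ coprime alpha h)
    (betaP : beta = 0%N \/ (0 < beta)%N /\ coprime beta k) :
  let xi (n : int) : R[i] := expi2pi R k n in
  let omega (n : int) : R[i] := expi2pi R h n in
  let nu (n : int) : R[i] := expi2pi R mu n in
  h%:R * mu%:R *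
      (\sum_(1 <= j < k)
         1 / ((xi (j%:Z + beta%:Z) ^+ mu * omega alpha%:Z ^+ mu + 1)
              * (xi j%:Z ^+ h - 1)))
  + k%:R * mu%:R *
      (\sum_(1 <= j < h)
         1 / ((xi beta%:Z ^+ mu * omega (alpha%:Z + j%:Z) ^+ mu + 1)
              * (omega j%:Z ^+ k - 1)))
  - h%:R * k%:R *
      (\sum_(1 <= j < mu.+1)
         1 / ((omega alpha%:Z ^+ k * nu j%:Z ^+ k + 1)
              * (xi beta%:Z ^+ h * nu j%:Z ^+ h + 1)))
  = - (h%:R * k%:R * mu%:R
       * (1 / (omega alpha%:Z ^+ (k * mu)%N + 1)
          + 1 / (xi beta%:Z ^+ (h * mu)%N + 1)))
    + mu%:R * (mu%:R + k%:R / 2 + h%:R / 2)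
      * (1 / (xi beta%:Z ^+ mu * omega alpha%:Z ^+ mu + 1))
    - mu%:R ^+ 2 / (xi beta%:Z ^+ mu * omega alpha%:Z ^+ mu + 1) ^+ 2.
Proof.
exact: (power_reciprocity _ h k mu alpha beta _ _ _ odd_h odd_k odd_mu
  co_hk co_hmu co_kmu (expi2piX R k) (expi2piX R h) (expi2piX R mu)
  (expi2pi_prim R k (odd_gt0 odd_k)) (expi2pi_prim R h (odd_gt0 odd_h))
  (expi2pi_prim R mu mu_gt0)).
Qed.
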